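(* Let $X$ be a real normed linear space and let $A\subset X$, $B\subset\mathbb{R}^n$ be convex sets. Let $F=(F_1,\dots,F_n)\colon A\to B$ be a d.c. mapping and $g\colon B\to\mathbb{R}$ a d.c. function. Then $g\circ F$ is d.c. on $A$, provided at least one of the following conditions is satisfied: (a) $A$ is open, $F$ is d.c., and $g$ is a difference of two Lipschitz convex functions on $B$; (b) each $F_i$ is a difference of two continuous convex functions on $A$ which are bounded on bounded subsets of $A$, and the restriction of $g$ to each bounded convex subset of $B$ is a difference of two Lipschitz convex functions; (c) $X=\mathbb{R}^k$, $A$ is open or closed, $F$ is d.c., and, for each $a\in A$, there exists $\varepsilon>0$ such that $g$ is a difference of two Lipschitz convex functions on $B\cap B(F(a),\varepsilon)$.
   Context: A real function on a convex subset $C$ of a real normed linear space is called d.c. (delta-convex) if it is the difference of two continuous convex functions on $C$. A mapping into $\mathbb{R}^n$ defined on $C$ is d.c. if each of its $n$ components is a d.c. function. $B(y,\varepsilon)$ denotes the open ball with center $y$ and radius $\varepsilon$ (whereas $B$ alone is the given convex set). *)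

(* Defs.v *)
From HB Require Import structures.
From mathcomp Require Import all_boot all_order all_algebra.
From mathcomp Require Import boolp classical_sets reals topology normedtype.
From mathcomp Require Import convex.

Set Implicit Arguments.
Unset Strict Implicit.
Unset Printing Implicit Defensive.

Import Order.TTheory GRing.Theory Num.Theory.
Import numFieldNormedType.Exports.

Local Open Scope classical_set_scope.
Local Open Scope ring_scope.

(* A function on a subset C of E is represented by a total function E -> R of
   which only the values on C matter.

   R^n is 'rV[R]_n, whose library norm is the maximum norm.  Open and closed
   sets, continuity, boundedness, Lipschitz functions, and the existence of a
   ball around a point with a given hereditary property are the same for every
   norm on R^n. *)

Section DeltaConvex.
Variables (R : realType) (E : normedModType R).
Implicit Types (C : set E) (f u v : E -> R).

Definition difference_of (P : (E -> R) -> Prop) C f : Prop :=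
  exists u v, [/\ P u, P v & forall x, C x -> f x = u x - v x].

(* [{within C, continuous u}] is continuity for the subspace topology of C, not
   continuity at the points of C of the total function u. *)
Definition continuous_convex C u : Prop :=
  {within C, continuous u} /\ convex_function C u.

Definition lipschitz_convex C u : Prop :=
  [lipschitz u x | x in C] /\ convex_function C u.

Definition dc C f : Prop := difference_of (continuous_convex C) C f.

Definition lipschitz_dc C f : Prop := difference_of (lipschitz_convex C) C f.

Definition bounded_on_bounded C u : Prop :=
  forall S : set E, S `<=` C -> bounded_set S -> [bounded u x | x in S].

Definition bounded_dc C f : Prop :=
  difference_of (fun u => continuous_convex C u /\ bounded_on_bounded C u) C f.

Definition dc_map n C (F : E -> 'rV[R]_n) : Prop :=
  forall i, dc C (fun x => F x ord0 i).

End DeltaConvex.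

(* Main.v *)
Require Import Defs.
From HB Require Import structures.
From mathcomp Require Import all_boot all_order all_algebra.
From mathcomp Require Import boolp classical_sets reals topology normedtype.
From mathcomp Require Import convex.
From mathcomp Require Import unstable interval_inference derive ring lra.

Set Implicit Arguments.
Unset Strict Implicit.
Unset Printing Implicit Defensive.

Import Order.TTheory GRing.Theory Num.Theory.
Import numFieldNormedType.Exports.

Local Open Scope classical_set_scope.
Local Open Scope ring_scope.

(* A Lipschitz convex function composed with F = u - v becomes convex after
   adding L * sum_i (u_i + v_i), because the convexity defect of F_i is the
   difference of the nonnegative defects of u_i and v_i; this is (a).  Moreover a
   Lipschitz convex function on a convex set extends to the whole of R^n, so that
   a decomposition of g on a part of B yields a continuous convex function k on
   all of A such that g o F + k is convex on a part of A.  In (b) the parts are the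
   bounded subsets of A.  In (c) they are neighborhoods; sums of finitely many such
   k serve on compact convex sets, and A is exhausted by the sublevel sets of a
   convex function psi: the norm if A is closed, the norm plus the inverse of the
   distance to the complement if A is open.  Finally, the functions k_m that serve
   on {psi <= m} are glued into a single one by taking maxima with
   k_m + c (2 max(0, psi - m) - 1), as in Hartman's theorem. *)

(** * Convexity with two explicit weights *)

Section Convexity.
Variables (R : realType) (E : normedModType R).
Implicit Types (A C : set E) (f u v : E -> R).

Lemma convex_setP C :
  convex_set C <->
  forall x y (s t : R), C x -> C y -> 0 <= s -> 0 <= t -> s + t = 1 ->
    C (s *: x + t *: y).
Proof.
split=> [cC x y s t Cx Cy s0 t0 st|cC x y l].
  have s1 : s <= 1 by lra.
  have := cC x y (Itv01 s0 s1); rewrite !inE => /(_ Cx Cy).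
  have -> : t = 1 - s by lra.
  exact.
by rewrite !inE => Cx Cy; apply: cC; rewrite ?onem_ge0 ?add_onemK.
Qed.

Lemma convex_functionP C f :
  convex_function C f <->
  forall x y (s t : R), C x -> C y -> 0 <= s -> 0 <= t -> s + t = 1 ->
    f (s *: x + t *: y) <= s * f x + t * f y.
Proof.
split=> [cf x y s t Cx Cy s0 t0 st|cf l x y].
  have s1 : s <= 1 by lra.
  have := cf (Itv01 s0 s1) x y; rewrite !inE => /(_ Cx Cy).
  have -> : t = 1 - s by lra.
  exact.
by rewrite !inE => Cx Cy; apply: cf; rewrite ?onem_ge0 ?add_onemK.
Qed.

End Convexity.

(** * Continuity relative to a subset *)

Lemma within_continuous_comp_in (T U V : topologicalType) (A : set T) (B : set U)
    (f : T -> U) (g : U -> V) :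
  f @` A `<=` B -> {within A, continuous f} -> {within B, continuous g} ->
  {within A, continuous (g \o f)}.
Proof.
move=> fAB /subspace_continuousP cf /subspace_continuousP cg.
apply/subspace_continuousP => x Ax W nW.
have fW : \forall y \near x, A y -> B (f y) -> W (g (f y)).
  exact: (cf x Ax _ (cg (f x) (fAB _ (imageP f Ax)) _ nW)).
have : \forall y \near x, A y -> W (g (f y)); last by [].
by apply: filterS fW => y + Ay => /(_ Ay); apply; exact: (fAB _ (imageP f Ay)).
Qed.

Section WithinContinuous.
Variables (R : realType) (T : topologicalType) (A : set T).
Implicit Types f g : T -> R.

Lemma within_continuousZ (c : R) f :
  {within A, continuous f} -> {within A, continuous (fun x => c * f x)}.
Proof.
move=> /subspace_continuousP cf.
by apply/subspace_continuousP => x Ax; exact: cvgM (cvg_cst c) (cf x Ax).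
Qed.

Lemma within_continuous_max f g :
  {within A, continuous f} -> {within A, continuous g} ->
  {within A, continuous (fun x => Num.max (f x) (g x))}.
Proof. by move=> cf cg x; apply: continuous_max; [exact: cf|exact: cg]. Qed.

Lemma within_continuous_sum (I : finType) (f : I -> T -> R) :
  (forall i, {within A, continuous (f i)}) ->
  {within A, continuous (fun x => \sum_i f i x)}.
Proof.
move=> cf; apply: continuous_big => [|i _]; last exact: cf.
exact: add_continuous.
Qed.

Lemma locally_within_continuous g :
  (forall x, A x -> exists2 f, {within A, continuous f} &
     \forall y \near x, A y -> f y = g y) ->
  {within A, continuous g}.
Proof.
move=> fg; apply/subspace_continuousP => x Ax.
have [f /subspace_continuousP cf fgx] := fg x Ax.
have : f @ within A (nbhs x) --> nbhs (f x) := cf x Ax.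
have /= -> : f x = g x := nbhs_singleton fgx Ax.
by apply: cvg_trans; exact: (near_eq_cvg fgx).
Qed.

End WithinContinuous.

(** * Lipschitz, bounded and convex functions; convexity as a local property *)

Section NormedModule.
Variables (R : realType) (E : normedModType R).
Implicit Types (A C : set E) (f u v : E -> R).

Lemma lipschitzP C u :
  [lipschitz u x | x in C] <->
  exists2 L : R, 0 <= L &
    forall x y, C x -> C y -> `|u x - u y| <= L * `|x - y|.
Proof.
split=> [/pinfty_ex_gt0[L L0 uL]|[L L0 uL]].
  by exists L; rewrite ?ltW// => x y Cx Cy; exact: (uL (x, y) (conj Cx Cy)).
exists L; split; rewrite ?num_real// => M LM [x y] [/= Cx Cy].
by apply: le_trans (uL _ _ Cx Cy) _; rewrite ler_wpM2r// ltW.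
Qed.

Lemma boundedP (V : pseudoMetricNormedZmodType R) (T : Type) (S : set T) (u : T -> V) :
  [bounded u x | x in S] <-> exists M : R, forall x, S x -> `|u x| <= M.
Proof.
split=> [/pinfty_ex_gt0[M _ uM]|[M uM]]; first by exists M.
exists M; split; rewrite ?num_real// => N /ltW MN x Sx.
exact: le_trans (uM _ Sx) MN.
Qed.

Lemma convex_functionS A C f : A `<=` C -> convex_function C f ->
  convex_function A f.
Proof.
move=> AC /convex_functionP fC; apply/convex_functionP => x y s t Ax Ay.
by apply: fC; apply: AC.
Qed.

Lemma convex_function_cst C (c : R) : convex_function C (fun=> c : R).
Proof. by apply/convex_functionP => x y s t _ _ _ _ st; rewrite -mulrDl st mul1r. Qed.

Lemma convex_functionD C u v : convex_function C u -> convex_function C v ->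
  convex_function C (fun x => u x + v x).
Proof.
move=> /convex_functionP cu /convex_functionP cv.
apply/convex_functionP => x y s t Cx Cy s0 t0 st.
by have := cu x y s t Cx Cy s0 t0 st; have := cv x y s t Cx Cy s0 t0 st; lra.
Qed.

Lemma convex_functionZ C (c : R) u : 0 <= c -> convex_function C u ->
  convex_function C (fun x => c * u x).
Proof.
move=> c0 /convex_functionP cu; apply/convex_functionP => x y s t Cx Cy s0 t0 st.
have := ler_wpM2l c0 (cu x y s t Cx Cy s0 t0 st); lra.
Qed.

Lemma convex_function_max C u v : convex_function C u -> convex_function C v ->
  convex_function C (fun x => Num.max (u x) (v x)).
Proof.
move=> /convex_functionP cu /convex_functionP cv.
apply/convex_functionP => x y s t Cx Cy s0 t0 st; rewrite ge_max.
have Hu : s * u x + t * u y <= s * Num.max (u x) (v x) + t * Num.max (u y) (v y).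
  by rewrite lerD// ler_wpM2l// le_max lexx.
have Hv : s * v x + t * v y <= s * Num.max (u x) (v x) + t * Num.max (u y) (v y).
  by rewrite lerD// ler_wpM2l// le_max lexx orbT.
rewrite (le_trans (cu _ _ _ _ Cx Cy s0 t0 st))//.
by rewrite (le_trans (cv _ _ _ _ Cx Cy s0 t0 st)).
Qed.

Lemma convex_function_norm C : convex_function C (fun x => `|x|).
Proof.
apply/convex_functionP => x y s t _ _ s0 t0 _.
by rewrite (le_trans (ler_normD _ _))// !normrZ !ger0_norm.
Qed.

Lemma eq_convex_function C u v : (forall x, C x -> u x = v x) ->
  convex_set C -> convex_function C u -> convex_function C v.
Proof.
move=> uv /convex_setP cC /convex_functionP cu.
apply/convex_functionP => x y s t Cx Cy s0 t0 st.
by rewrite -!uv//; [apply: cu|apply: cC].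
Qed.

(** If convexity fails on a segment, the excess of [h] over the chord, slightly perturbed, has an
    interior maximum there, which convexity near that point forbids. Every passage from local to
    global convexity below rests on this. *)
Lemma locally_convex_function C (h : E -> R) :
  convex_set C -> {within C, continuous h} ->
  (forall a, C a -> exists2 U, nbhs a U & convex_function (C `&` U) h) ->
  convex_function C h.
Proof.
move=> /convex_setP cC ch loc; apply/convex_functionP => x y s t Cx Cy s0 t0 st.
pose g (r : R) := r *: x + (1 - r) *: y.
have cg : continuous g.
  move=> r; apply: cvgD; apply: cvgZ; [|exact: cvg_cst| |exact: cvg_cst].
    exact: cvg_id.
  by apply: cvgB; [exact: cvg_cst|exact: cvg_id].
have Cg r : 0 <= r -> r <= 1 -> C (g r).
  by move=> r0 r1; apply: cC => //; lra.
pose d r := h (g r) - (r * h x + (1 - r) * h y).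
rewrite leNgt; apply/negP => hlt.
have tE : t = 1 - s by lra.
have d0 : 0 < d s by rewrite /d /g -tE; lra.
(* The strictly convex term excludes plateaus: at an interior maximum of [de] the
   local convexity of [h] fails. *)
pose e := d s.
pose de r := d r + e * (r * r - r).
have cde : {within `[0%R, 1%R], continuous de}.
  have cp : continuous (fun r : R => e * (r * r - r) - (r * h x + (1 - r) * h y)).
    move=> r; have cid : (fun r : R => r) @ r --> r by exact: cvg_id.
    have c1 : (fun r => 1 - r : R) @ r --> 1 - r by exact: cvgB (cvg_cst _) cid.
    apply: cvgB; first exact: cvgM (cvg_cst e) (cvgB (cvgM cid cid) cid).
    exact: cvgD (cvgM cid (cvg_cst (h x))) (cvgM c1 (cvg_cst (h y))).
  have chg : {within `[0%R, 1%R], continuous (h \o g)}.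
    apply: (within_continuous_comp_in _ (continuous_subspaceT cg) ch) => _ [u + <-].
    by rewrite /= in_itv/= => /andP[]; exact: Cg.
  have -> : de = fun r => (h \o g) r + (e * (r * r - r) - (r * h x + (1 - r) * h y)).
    by apply/funext => r; rewrite /de /d /=; lra.
  exact: within_continuousD chg (continuous_subspaceT cp).
have [c] := EVT_max ler01 cde.
rewrite in_itv/= => /andP[c0 c1] cmax.
have sc : de s <= de c by apply: cmax; rewrite in_itv/= s0; lra.
(* With [e = d s] the quadratic term takes away at most a quarter of [d s]. As [de] vanishes at 0
   and 1, its maximum is then attained in the interior. *)
have des : 0 < de s.
  have : 0 < d s * (1 + s * s - s) by rewrite mulr_gt0//; nra.
  by rewrite /de /e; lra.
have {}c0 : 0 < c.
  rewrite lt_neqAle c0 andbT; apply/eqP => c0'.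
  move: (lt_le_trans des sc); rewrite /de /d /g -c0' subr0 scale0r add0r scale1r; lra.
have {}c1 : c < 1.
  rewrite lt_neqAle c1 andbT; apply/eqP => c1'.
  move: (lt_le_trans des sc); rewrite /de /d /g c1' subrr scale0r addr0 scale1r; lra.
have [U nU cU] := loc _ (Cg c (ltW c0) (ltW c1)).
have /nbhs_ballP[r /= r0 rU] := cg c _ nU.
(* This step keeps [c + k] and [c - k] in the unit interval and strictly within distance [r] of [c],
   so that [g] maps them into [U]. *)
pose k := Num.min (r / 2) (Num.min c (1 - c)).
have k0 : 0 < k by rewrite !lt_min; apply/and3P; split; lra.
have [kr kc k1] : [/\ k <= r / 2, k <= c & k <= 1 - c].
  by rewrite /k !ge_min !lexx !orbT.
have Up : U (g (c + k)).
  by apply: rU; rewrite /ball/= opprD addNKr normrN gtr0_norm//; lra.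
have Um : U (g (c - k)).
  by apply: rU; rewrite /ball/= subKr gtr0_norm//; lra.
have dp : de (c + k) <= de c by apply: cmax; rewrite in_itv/=; lra.
have dm : de (c - k) <= de c by apply: cmax; rewrite in_itv/=; lra.
(* The chord is affine and cancels in the second difference of [de] at [c]; [h] contributes a
   nonnegative amount and the quadratic term [2 * e * k * k > 0], against maximality at [c]. *)
move/convex_functionP : cU => /(_ (g (c + k)) (g (c - k)) 2^-1 2^-1).
have -> : 2^-1 *: g (c + k) + 2^-1 *: g (c - k) = g c.
  rewrite /g !scalerDr !scalerA addrACA -!scalerDl; congr (_ *: _ + _ *: _); lra.
have Cp : C (g (c + k)) by apply: Cg; lra.
have Cm : C (g (c - k)) by apply: Cg; lra.
move=> /(_ (conj Cp Up) (conj Cm Um)).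
move: dp dm; rewrite /de /d /e.
have : 0 < d s * (k * k) by rewrite !mulr_gt0.
set hc := h (g c); set hp := h (g (c + k)); set hm := h (g (c - k)).
move=> ek dp dm /(_ ltac:(lra) ltac:(lra) ltac:(lra)); lra.
Qed.

End NormedModule.

(** * The maximum norm and maps given by coordinates *)

(** The zero vector is excluded because for [n = 0] there is no coordinate to choose. *)
Lemma rV_norm_coord (R : realType) n (v : 'rV[R]_n) :
  v != 0 -> exists j, `|v| = `|v ord0 j|.
Proof.
move=> v0; have /mx_norm_neq0[[i j] vij] : mx_norm v != 0.
  by apply: contra_neq v0 => /mx_norm_eq0.
by exists j; rewrite [LHS]vij ord1.
Qed.

Lemma rV_norm_le_sum (R : realType) n (v : 'rV[R]_n) :
  `|v| <= \sum_i `|v ord0 i|.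
Proof.
have [->|/rV_norm_coord[j ->]] := eqVneq v 0; first by rewrite normr0 sumr_ge0.
by rewrite (bigD1 j)//= lerDl sumr_ge0.
Qed.

Lemma within_continuous_rV (R : realType) (T : topologicalType) n
    (A : set T) (F : T -> 'rV[R]_n) :
  (forall i, {within A, continuous (fun x => F x ord0 i)}) -> {within A, continuous F}.
Proof.
move=> cF; apply/subspace_continuousP => x Ax; apply/cvgrPdist_lt => e e0.
have : \forall y \near within A (nbhs x), forall i, `|F x ord0 i - F y ord0 i| < e.
  apply: filter_forall => i.
  by have /subspace_continuousP/(_ x Ax)/cvgrPdist_lt := cF i; apply.
apply: filterS => y ye.
have [->|/rV_norm_coord[j ->]] := eqVneq (F x - F y) 0; first by rewrite normr0.
by rewrite !mxE.
Qed.

Lemma dc_within_continuous (R : realType) (E : normedModType R) (A : set E) (f : E -> R) :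
  dc A f -> {within A, continuous f}.
Proof.
move=> [u [v [[cu _] [cv _] fE]]]; apply: locally_within_continuous => x Ax.
exists (fun x => u x + (-1) * v x).
  by apply: within_continuousD => //; exact: within_continuousZ.
by near=> y => Ay; rewrite fE// mulN1r.
Unshelve. all: by end_near. Qed.

(** * Extension and composition of Lipschitz convex functions *)

Section LipschitzConvex.
Variables (R : realType) (E : normedModType R).
Implicit Types (C S : set E).

(** The extension is the infimal convolution of [g] with [L] times the norm. The Lipschitz bound
    makes the infimum finite and equal to [g] on [C]. Convexity follows by combining
    near-minimizers, as [g c + L * |y - c|] is jointly convex in [c] and [y]. *)
Lemma lipschitz_convex_extension C (g : E -> R) (L : R) :
  0 <= L -> (forall x y, C x -> C y -> `|g x - g y| <= L * `|x - y|) ->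
  convex_set C -> convex_function C g ->
  exists g' : E -> R, [/\ forall x y, `|g' x - g' y| <= L * `|x - y|,
    convex_function setT g' & forall x, C x -> g' x = g x].
Proof.
move=> L0 gL /convex_setP cC /convex_functionP cg.
have [[a Ca]|C0] := pselect (C !=set0); last first.
  exists (fun=> 0); split => [x y||x Cx]; last by case: C0; exists x.
    by rewrite subrr normr0 mulr_ge0.
  exact: convex_function_cst.
pose V (y : E) := [set g c + L * `|y - c| | c in C].
pose g' y := inf (V y).
have lbV y c : C c -> lbound (V y) (g c - L * `|y - c|).
  move=> Cc _ [d Cd <-]; have := gL _ _ Cc Cd; have := ler_normD (c - y) (y - d).
  rewrite addrA subrK (distrC c y) => /(ler_wpM2l L0); rewrite mulrDr.
  by move=> h /(le_trans (ler_norm _)); lra.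
have V0 y : V y !=set0 by exists (g a + L * `|y - a|), a.
have hV y : has_inf (V y) by split => //; exists (g a - L * `|y - a|); apply: lbV.
have g'le y c : C c -> g' y <= g c + L * `|y - c|.
  by move=> Cc; apply: ge_inf; [exact: (hV y).2|exists c].
have g'C y : C y -> g' y = g y.
  move=> Cy; apply/le_anti/andP; split.
    by have := g'le y y Cy; rewrite subrr normr0 mulr0 addr0.
  by apply: lb_le_inf => //; have := lbV y y Cy; rewrite subrr normr0 mulr0 subr0.
have g'L x y : g' x - L * `|x - y| <= g' y.
  apply: lb_le_inf => // _ [c Cc <-]; have := g'le x c Cc.
  have := ler_normD (x - y) (y - c); rewrite addrA subrK => /(ler_wpM2l L0).
  by rewrite mulrDr; lra.
exists g'; split => // [x y|].
  by have := g'L x y; have := g'L y x; rewrite (distrC y x) ler_norml; lra.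
apply/convex_functionP => x y s t _ _ s0 t0 st; apply/ler_addgt0Pr => e e0.
have [_ [c Cc <-] xc] := inf_adherent e0 (hV x).
have [_ [d Cd <-] yd] := inf_adherent e0 (hV y).
have := g'le (s *: x + t *: y) _ (cC _ _ _ _ Cc Cd s0 t0 st).
have := cg _ _ _ _ Cc Cd s0 t0 st.
have : `|s *: x + t *: y - (s *: c + t *: d)| <= s * `|x - c| + t * `|y - d|.
  rewrite opprD addrACA -!scalerBr (le_trans (ler_normD _ _))//.
  by rewrite !normrZ !ger0_norm.
move=> /(ler_wpM2l L0).
have := ler_wpM2l s0 (ltW xc); have := ler_wpM2l t0 (ltW yd).
rewrite -/(g' x) -/(g' y).
have : s * e + t * e = e by rewrite -mulrDl st mul1r.
by lra.
Qed.

Lemma convex_function_comp n S (C : set 'rV[R]_n) (F : E -> 'rV[R]_n)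
    (u v : 'I_n -> E -> R) (g : 'rV[R]_n -> R) (L : R) :
  0 <= L -> (forall x y, C x -> C y -> `|g x - g y| <= L * `|x - y|) ->
  convex_set C -> convex_function C g ->
  convex_set S -> F @` S `<=` C ->
  (forall i, convex_function S (u i)) -> (forall i, convex_function S (v i)) ->
  (forall i x, S x -> F x ord0 i = u i x - v i x) ->
  convex_function S (fun x => g (F x) + L * \sum_i (u i x + v i x)).
Proof.
move=> L0 gL /convex_setP cC /convex_functionP cg /convex_setP cS FS cu cv FE.
apply/convex_functionP => x y s t Sx Sy s0 t0 st.
have Sz := cS x y s t Sx Sy s0 t0 st; set z := s *: x + t *: y in Sz *.
have CF w : S w -> C (F w) by move=> Sw; apply: FS; exists w.
(* The point [m] on the chord of images separates two estimates: the Lipschitz bound compares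
   [g (F z)] with [g m], and convexity bounds [g m]. *)
have Cm := cC _ _ s t (CF x Sx) (CF y Sy) s0 t0 st.
set m := s *: F x + t *: F y in Cm.
have gz := le_trans (ler_norm _) (gL _ _ (CF z Sz) Cm).
have gm : g m <= s * g (F x) + t * g (F y) := cg _ _ _ _ (CF x Sx) (CF y Sy) s0 t0 st.
(* The defect of [F i] at [z] is the difference of the nonnegative defects of
   [u i] and [v i], hence bounded by their sum. *)
have Fz : `|F z - m| <= s * (\sum_i (u i x + v i x)) + t * (\sum_i (u i y + v i y))
    - \sum_i (u i z + v i z).
  apply: le_trans (rV_norm_le_sum _) _.
  rewrite !mulr_sumr -big_split -sumrB; apply: ler_sum => i _ /=.
  rewrite !mxE !FE//.
  have /convex_functionP/(_ x y s t Sx Sy s0 t0 st) := cu i.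
  have /convex_functionP/(_ x y s t Sx Sy s0 t0 st) := cv i.
  by rewrite -/z ler_norml; lra.
by move: Fz => /(ler_wpM2l L0); lra.
Qed.

End LipschitzConvex.

(** * Gluing along sublevel sets and over compact sets *)

Section Gluing.
Variables (R : realType) (E : normedModType R).
Implicit Types (A C : set E) (f k psi : E -> R).

Lemma convex_setI A C : convex_set A -> convex_set C -> convex_set (A `&` C).
Proof.
move=> /convex_setP cA /convex_setP cC; apply/convex_setP => x y s t [Ax Cx] [Ay Cy] *.
by split; [apply: cA|apply: cC].
Qed.

Lemma convex_set_ball (a : E) (e : R) : convex_set (ball a e).
Proof.
apply/convex_setP => x y s t; rewrite -ball_normE /= => ax ay s0 t0 st.
have -> : a - (s *: x + t *: y) = s *: (a - x) + t *: (a - y).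
  by rewrite !scalerBr addrACA -scalerDl st scale1r -opprD.
rewrite (le_lt_trans (ler_normD _ _))// !normrZ !ger0_norm//.
have -> : e = s * e + t * e by rewrite -mulrDl st mul1r.
have [s00|s00] := eqVneq s 0; last first.
  by rewrite ltr_leD ?ltr_pM2l ?ler_wpM2l ?(ltW ay)// lt_neqAle eq_sym s00.
have t1 : t = 1 by lra.
by rewrite s00 t1 !mul0r !add0r !mul1r.
Qed.

Lemma convex_set_sublevel A psi (c : R) : convex_set A -> convex_function A psi ->
  convex_set (A `&` [set x | psi x <= c]).
Proof.
move=> /convex_setP cA /convex_functionP cp.
apply/convex_setP => x y s t [Ax /= xc] [Ay /= yc] s0 t0 st; split; first exact: cA.
rewrite (le_trans (cp _ _ _ _ Ax Ay s0 t0 st))//.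
have := ler_wpM2l s0 xc; have := ler_wpM2l t0 yc.
have : s * c + t * c = c by rewrite -mulrDl st mul1r.
by lra.
Qed.

Lemma continuous_convexD A f k : continuous_convex A f -> continuous_convex A k ->
  continuous_convex A (fun x => f x + k x).
Proof.
by move=> [? ?] [? ?]; split; [exact: within_continuousD|exact: convex_functionD].
Qed.

Lemma continuous_convexZ A (c : R) f : 0 <= c -> continuous_convex A f ->
  continuous_convex A (fun x => c * f x).
Proof.
by move=> ? [? ?]; split; [exact: within_continuousZ|exact: convex_functionZ].
Qed.

Lemma continuous_convex_cst A (c : R) : continuous_convex A (fun=> c).
Proof.
by split; [exact/continuous_subspaceT/cst_continuous|exact: convex_function_cst].
Qed.

Lemma continuous_convex_max A f k : continuous_convex A f -> continuous_convex A k ->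
  continuous_convex A (fun x => Num.max (f x) (k x)).
Proof.
by move=> [? ?] [? ?]; split; [exact: within_continuous_max|exact: convex_function_max].
Qed.

(** Only the convexity of [f + k] is confined to the sublevel set of [c]; [k] is convex on all of
    [A], so it can enter later stages. Boundedness on every sublevel set supplies the finite
    constant of the gluing. *)
Definition controls A psi f (c : R) k :=
  [/\ continuous_convex A k,
      forall t, [bounded k x | x in A `&` [set x | psi x <= t]] &
      convex_function (A `&` [set x | psi x <= c]) (fun x => f x + k x)].

(** Take the maximum of [h] and a modification [G] of [k] that lies below [h] where [psi <= m] and,
    within [psi <= m + 3], above it where [psi >= m + 1]. Then [f + h'] is a maximum of convex
    functions where [psi < m + 2] and equals [f + G] where [psi > m + 1]. These regions overlap, and
    convexity is local. *)
Lemma controls_extend A psi f (m : R) h k :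
  convex_set A -> continuous_convex A psi -> {within A, continuous f} ->
  controls A psi f (m + 2) h -> controls A psi f (m + 3) k ->
  exists2 h', controls A psi f (m + 3) h' &
    forall x, A x -> psi x <= m -> h' x = h x.
Proof.
move=> cA [psic psicv] cf [hc hb fh] [kc kb fk].
have [M1 hM] := (boundedP _ _).1 (hb (m + 3)).
have [M2 kM] := (boundedP _ _).1 (kb (m + 3)).
pose c := `|M1| + `|M2|.
have c0 : 0 <= c by rewrite addr_ge0.
have hk x : A x -> psi x <= m + 3 -> `|h x - k x| <= c.
  move=> Ax px; rewrite (le_trans (ler_normB _ _))// lerD//.
    exact: le_trans (hM _ (conj Ax px)) (ler_norm _).
  exact: le_trans (kM _ (conj Ax px)) (ler_norm _).
(* [p] is [- c] where [psi <= m] and at least [c] where [psi >= m + 1], which outweighs the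
   difference of [h] and [k]. *)
pose p x := 2 * c * Num.max 0 (psi x - m) - c.
have pc : continuous_convex A p.
  apply: continuous_convexD; last exact: continuous_convex_cst.
  apply: continuous_convexZ; first by rewrite mulr_ge0.
  apply: continuous_convex_max; first exact: continuous_convex_cst.
  by apply: continuous_convexD => //; exact: continuous_convex_cst.
pose G x := k x + p x.
have Gc : continuous_convex A G by exact: continuous_convexD.
have fG : convex_function (A `&` [set x | psi x <= m + 3]) (fun x => f x + G x).
  have -> : (fun x => f x + G x) = (fun x => (f x + k x) + p x).
    by apply/funext => x; rewrite addrA.
  apply: convex_functionD => //.
  by apply: convex_functionS pc.2; exact: subIsetl.
have Gh x : A x -> psi x <= m -> G x <= h x.
  move=> Ax px; have : `|h x - k x| <= c by apply: hk => //; lra.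
  have -> : G x = k x - c by rewrite /G /p max_l ?mulr0 ?add0r// subr_le0.
  by rewrite ler_norml; lra.
have hG x : A x -> psi x <= m + 3 -> m + 1 <= psi x -> h x <= G x.
  move=> Ax px mx; have := hk x Ax px.
  have : 2 * c * 1 <= 2 * c * Num.max 0 (psi x - m).
    by rewrite ler_wpM2l ?mulr_ge0// le_max; apply/orP; right; lra.
  by rewrite /G /p ler_norml; lra.
exists (fun x => Num.max (h x) (G x)) => [|x Ax px]; last by apply: max_l; exact: Gh.
split; first exact: continuous_convex_max.
  move=> t; apply/boundedP.
  have [N1 hN] := (boundedP _ _).1 (hb t).
  have [N2 kN] := (boundedP _ _).1 (kb t).
  exists (N1 + (N2 + 2 * c * `|t - m| + c)) => x Kx.
  have := hN x Kx; have := kN x Kx; rewrite !ler_norml => kx hx.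
  have : 2 * c * Num.max 0 (psi x - m) <= 2 * c * `|t - m|.
    rewrite ler_wpM2l ?mulr_ge0// ge_max normr_ge0/= (le_trans _ (ler_norm _))//.
    by rewrite lerB//; exact: Kx.2.
  have : 0 <= 2 * c * Num.max 0 (psi x - m) by rewrite !mulr_ge0// le_max lexx.
  have : 0 <= 2 * c * `|t - m| by rewrite !mulr_ge0.
  move=> p0 t0 pt; rewrite ge_max le_max.
  by apply/and3P; split; [apply/orP; left| |]; rewrite ?/G ?/p; lra.
have cK := convex_set_sublevel (c := m + 3) cA psicv.
apply: locally_convex_function => //.
  apply: (@continuous_subspaceW _ _ _ A); first exact: subIsetl.
  apply: within_continuousD => //; apply: within_continuous_max; first exact: hc.1.
  exact: Gc.1.
move=> a [Aa /= pa].
have cpa : psi @ within A (nbhs a) --> psi a by move/subspace_continuousP: psic; exact.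
have [am|am] := ltP (psi a) (m + 2).
  exists [set x | A x -> psi x < m + 2]; first exact: (cvgr_lt _ cpa _ am).
  have -> : (fun x => f x + Num.max (h x) (G x)) =
            (fun x => Num.max (f x + h x) (f x + G x)).
    by apply/funext => x; rewrite addr_maxr.
  apply: convex_function_max; last by apply: convex_functionS fG; exact: subIsetl.
  by apply: convex_functionS fh => x [[Ax _] /(_ Ax) /ltW].
have {}am : m + 1 < psi a by lra.
(* The region [m + 1 < psi] need not be convex, so a ball is used. *)
have /nbhs_ballP[e /= e0 eU] : nbhs a [set x | A x -> m + 1 < psi x].
  exact: (cvgr_gt _ cpa _ am).
exists (ball a e); first exact: nbhsx_ballx.
apply: (@eq_convex_function _ _ _ (fun x => f x + G x)).
- by move=> x [[Ax px] /eU /(_ Ax) /ltW mx]; rewrite max_r//; exact: hG.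
- by apply: convex_setI => //; exact: convex_set_ball.
- by apply: convex_functionS fG; exact: subIsetl.
Qed.

(** Iterating [controls_extend] yields a sequence that no longer changes on [psi <= m] after stage
    [m]. Its limit [h] coincides locally with a member of the sequence, and [f = (f + h) - h]. *)
Lemma dc_of_controls A psi f :
  convex_set A -> continuous_convex A psi -> {within A, continuous f} ->
  (forall m : nat, exists k, controls A psi f m%:R k) -> dc A f.
Proof.
move=> cA psicc cf fk.
(* The choice function must be total: a function that is not a control is sent to itself. *)
have [|N NP] := @choice (nat * (E -> R))%type (E -> R) (fun mh h' =>
    controls A psi f (mh.1%:R + 2) mh.2 ->
    controls A psi f (mh.1.+1%:R + 2) h' /\
    forall x, A x -> psi x <= mh.1%:R -> h' x = mh.2 x).
  move=> [m h] /=; have [hc|] := pselect (controls A psi f (m%:R + 2) h);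
    last by exists h.
  have [k kc] := fk m.+3.
  have [|h' h'c h'h] := controls_extend cA psicc cf hc (k := k).
    by rewrite -natrD addn3.
  by exists h' => _; rewrite -addn1 natrD -addrA -[1 + 2]/(1%:R + 2%:R) -natrD.
(* Stage [m] controls up to [m + 2], the lead of two levels that [controls_extend] requires; hence
   the start at level 2. *)
have [h0 h0c] := fk 2.
pose H := fix H m := if m is m'.+1 then N (m', H m') else h0.
have HP m : controls A psi f (m%:R + 2) (H m).
  elim: m => [|m IH]; first by rewrite add0r.
  exact: (NP (m, H m) IH).1.
have HS m x : A x -> psi x <= m%:R -> H m.+1 x = H m x := (NP (m, H m) (HP m)).2 x.
have Hmono m j x : A x -> psi x <= m%:R -> H (m + j)%N x = H m x.
  move=> Ax px; elim: j => [|j IH]; first by rewrite addn0.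
  by rewrite addnS HS// (le_trans px)// ler_nat leq_addr.
(* The strict bound [psi x < b x] persists near [x] in [A], so one stage represents [h] there. *)
pose b x := Num.bound `|psi x|.
have pb x : psi x < (b x)%:R.
  by rewrite (le_lt_trans (ler_norm _))// archi_boundP.
pose h x := H (b x) x.
have hE m x : A x -> psi x <= m%:R -> H m x = h x.
  move=> Ax px; rewrite /h; have [mb|/ltnW bm] := leqP m (b x).
    by rewrite -(subnKC mb) Hmono.
  by rewrite -(subnKC bm) Hmono// ltW.
have cvxA u : (forall m : nat, convex_function (A `&` [set x | psi x <= m%:R]) u) ->
    convex_function A u.
  move=> cu; apply/convex_functionP => x y s t Ax Ay.
  have /convex_functionP := cu (maxn (b x) (b y)); apply; split => //=.
    by rewrite (le_trans (ltW (pb x)))// ler_nat leq_maxl.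
  by rewrite (le_trans (ltW (pb y)))// ler_nat leq_maxr.
have ch : {within A, continuous h}.
  apply: locally_within_continuous => a Aa.
  exists (H (b a)); first by have [[]] := HP (b a).
  have cpa : psi @ within A (nbhs a) --> psi a.
    by move/subspace_continuousP : psicc.1; exact.
  have nb : nbhs a [set x | A x -> psi x < (b a)%:R] by exact: (cvgr_lt _ cpa _ (pb a)).
  by apply: filterS nb => x + Ax => /(_ Ax) /ltW; exact: hE.
exists (fun x => f x + h x), h; split => [||x _]; last by rewrite addrK.
- split; first exact: within_continuousD.
  apply: cvxA => m; have [_ _ fH] := HP m.
  apply: (@eq_convex_function _ _ _ (fun x => f x + H m x)).
  + by move=> x [Ax px]; rewrite (hE m).
  + exact: convex_set_sublevel psicc.2.
  + by apply: convex_functionS fH => x [Ax /= px]; split=> //=; lra.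
- split => //; apply: cvxA => m; have [[_ cH] _ _] := HP m.
  apply: (@eq_convex_function _ _ _ (H m)).
  + by move=> x [Ax px]; rewrite (hE m).
  + exact: convex_set_sublevel psicc.2.
  + by apply: convex_functionS cH; exact: subIsetl.
Qed.

(** If [Q K] failed, the sets [S] with [Q (K \ S)] would form a proper filter; at a cluster point, a
    neighborhood satisfying [Q] would have its complement in the filter. *)
Lemma compact_ind (T : topologicalType) (K : set T) (Q : set T -> Prop) :
  compact K -> Q set0 -> (forall U V, U `<=` V -> Q V -> Q U) ->
  (forall U V, Q U -> Q V -> Q (U `|` V)) ->
  (forall a, K a -> exists2 U, nbhs a U & Q U) -> Q K.
Proof.
move=> cK Q0 QS QU Qloc; apply: contrapT => nQK.
pose F : set_system T := [set S | Q (K `\` S)].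
have FF : ProperFilter F.
  apply: Build_ProperFilter_ex => [S /= QKS|]; last split.
  - apply: contrapT => S0; apply: nQK; apply: QS QKS => x Kx; split=> // Sx.
    by apply: S0; exists x.
  - by rewrite /F /= setDT.
  - by move=> S S' QS1 QS2; rewrite /F /= setDIr; exact: QU.
  - by move=> S S' SS'; apply: QS; exact: setDS.
have [|a [Ka aF]] := cK F FF; first by rewrite /F /= setDv.
have [U nU QU'] := Qloc a Ka.
have [|x [/= nUx Ux]] := aF (~` U) U _ nU; last by [].
by rewrite /F /= setDE setCK; apply: QS QU'; exact: subIsetr.
Qed.

Lemma compact_control A (K : set E) f :
  compact K -> convex_set K -> K `<=` A -> {within A, continuous f} ->
  (forall a, A a -> exists U k, [/\ nbhs a U, continuous_convex A k &
     convex_function (A `&` U) (fun x => f x + k x)]) ->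
  exists2 k, continuous_convex A k & convex_function K (fun x => f x + k x).
Proof.
move=> cK cvK KA cf loc.
(* Convexity is required near each point of [U] rather than on [U], so that [Q] passes to unions by
   adding the functions [k]. *)
pose Q (U : set E) := exists2 k, continuous_convex A k &
  forall a, U a -> exists2 V, nbhs a V & convex_function (A `&` V) (fun x => f x + k x).
suff [k kc kK] : Q K.
  exists k => //; apply: locally_convex_function => //.
    by apply: continuous_subspaceW KA _; apply: within_continuousD => //; exact: kc.1.
  move=> a /kK[V nV fkV]; exists V => //.
  by apply: convex_functionS fkV; exact: setSI.
apply: (compact_ind cK).
- by exists (fun=> 0) => //; exact: continuous_convex_cst.
- by move=> U V UV [k kc kV]; exists k => // a /UV; exact: kV.
- move=> U V [k kc kU] [l lc lV]; exists (fun x => k x + l x).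
    exact: continuous_convexD.
  move=> a [/kU|/lV] [W nW fW]; exists W => //.
    have -> : (fun x => f x + (k x + l x)) = (fun x => f x + k x + l x).
      by apply/funext => x; rewrite addrA.
    by apply: convex_functionD => //; apply: convex_functionS lc.2; exact: subIsetl.
  have -> : (fun x => f x + (k x + l x)) = (fun x => f x + l x + k x).
    by apply/funext => x; rewrite addrA addrAC.
  by apply: convex_functionD => //; apply: convex_functionS kc.2; exact: subIsetl.
- move=> a Ka; have [U [k [nU kc fk]]] := loc a (KA _ Ka).
  exists (U°); first exact: nbhs_interior.
  by exists k => // x Ux; exists U.
Qed.

End Gluing.

(** * Exhaustion of open or closed convex sets by compact sublevel sets *)

Section Exhaustion.
Variables (R : realType) (E : normedModType R).
Implicit Types (A W : set E).

Lemma continuous_convex_norm A : continuous_convex A (fun x => `|x|).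
Proof.
split; last exact: convex_function_norm.
by apply: continuous_subspaceT => x; exact: cvg_norm.
Qed.

Lemma convex_comb_gt0 (a b s t : R) :
  0 < a -> 0 < b -> 0 <= s -> 0 <= t -> s + t = 1 -> 0 < s * a + t * b.
Proof.
move=> a0 b0 s0 t0 st; have [s00|s00] := eqVneq s 0; last first.
  by rewrite ltr_wpDr ?mulr_ge0 ?(ltW b0)// mulr_gt0// lt_neqAle eq_sym s00.
have t1 : t = 1 by lra.
by rewrite s00 t1 mul0r add0r mul1r.
Qed.

(** Multiplied out, this reduces to [2 <= b / a + a / b]. *)
Lemma ler_inv_convex (a b s t : R) : 0 < a -> 0 < b -> 0 <= s -> 0 <= t -> s + t = 1 ->
  (s * a + t * b)^-1 <= s * a^-1 + t * b^-1.
Proof.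
move=> a0 b0 s0 t0 st.
have ab0 : 0 < s * a + t * b by exact: convex_comb_gt0.
rewrite -[leLHS]mul1r ler_pdivrMr//.
have xy : (b / a) * (a / b) = 1 by field; rewrite !gt_eqF.
have x0 : 0 < b / a by rewrite divr_gt0.
have y0 : 0 < a / b by rewrite divr_gt0.
have xy2 : 2 <= b / a + a / b.
  move: (b / a) (a / b) xy x0 y0 => p q pq p0 q0; have := sqr_ge0 (p - q); nra.
have -> : (s * a^-1 + t * b^-1) * (s * a + t * b) =
    s * s + t * t + s * t * (b / a + a / b) by field; rewrite !gt_eqF.
have -> : t = 1 - s by lra.
rewrite [leLHS](_ : _ = s * s + (1 - s) * (1 - s) + s * (1 - s) * 2); last by ring.
rewrite lerD2l ler_wpM2l// mulr_ge0//; lra.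
Qed.

Lemma klipschitz_continuous (f : E -> R) (L : R) :
  (forall x y, `|f x - f y| <= L * `|x - y|) -> continuous f.
Proof.
move=> fL x; apply/cvgrPdist_le => e e0.
(* No sign of [L] is assumed; this constant is positive and dominates it. *)
have M0 : 0 < `|L| + 1 by rewrite ltr_pwDr.
have /cvgrPdist_le/(_ (e / (`|L| + 1))) : y @[y --> x] --> x by exact: cvg_id.
rewrite divr_gt0// => /(_ isT); apply: filterS => y.
rewrite ler_pdivlMr// => xy; apply: le_trans (fL x y) _; apply: le_trans xy.
by rewrite mulrC ler_wpM2l// (le_trans (ler_norm _))// lerDl.
Qed.

Definition dist (W : set E) (x : E) : R := inf [set `|x - w| | w in W].

Lemma dist_le W x y : W y -> dist W x <= `|x - y|.
Proof. by move=> Wy; apply: ge_inf; [exists 0 => _ [w _ <-]|exists y]. Qed.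

Lemma le_dist W x (c : R) : W !=set0 -> (forall w, W w -> c <= `|x - w|) ->
  c <= dist W x.
Proof.
move=> [w0 Ww0] cW; apply: lb_le_inf => [|_ [w Ww <-]]; last exact: cW.
by exists `|x - w0|, w0.
Qed.

Lemma dist_mem0 W x : W x -> dist W x = 0.
Proof.
move=> Wx; apply/le_anti; rewrite le_dist ?andbT//; last by exists x.
by have := dist_le x Wx; rewrite subrr normr0.
Qed.

Lemma continuous_dist W : W !=set0 -> continuous (dist W).
Proof.
move=> W0; have dL x y : dist W x - `|x - y| <= dist W y.
  apply: le_dist => // w Ww; rewrite lerBlDr (le_trans (dist_le x Ww))//.
  by rewrite [leRHS]addrC -[x - w](subrKA y) ler_normD.
apply: (klipschitz_continuous (L := 1)) => x y; rewrite mul1r.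
by have := dL x y; have := dL y x; rewrite (distrC y x) ler_norml; lra.
Qed.

Lemma dist_gt0 W x : W !=set0 -> closed W -> ~ W x -> 0 < dist W x.
Proof.
move=> W0 cW Wx; have /nbhs_ballP[e /= e0 eW] : nbhs x (~` W).
  by apply: open_nbhs_nbhs; split => //; exact: closed_openC.
apply: lt_le_trans e0 _; apply: le_dist => // w Ww; rewrite leNgt; apply/negP => xw.
by apply: (eW w) => //; rewrite -ball_normE.
Qed.

Lemma dist_setC_concave A x y (s t : R) :
  open A -> convex_set A -> ~` A !=set0 -> A x -> A y ->
  0 <= s -> 0 <= t -> s + t = 1 ->
  s * dist (~` A) x + t * dist (~` A) y <= dist (~` A) (s *: x + t *: y).
Proof.
move=> oA cA A0 Ax Ay s0 t0 st; set d := dist (~` A).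
have dA p : A p -> 0 < d p.
  by move=> Ap; apply: dist_gt0 => //; exact: open_closedC.
apply: le_dist => // w Aw; rewrite leNgt; apply/negP => zw.
set D := s * d x + t * d y in zw; set z := s *: x + t *: y in zw.
have D0 : 0 < D by exact: le_lt_trans zw.
(* [w] is the combination of the points obtained by moving [x] and [y] in the
   direction [w - z], in proportion to their distances to the complement. *)
have move_in p : A p -> A (p + (d p / D) *: (w - z)).
  move=> Ap; apply: contrapT => /(@dist_le (~` A) p); apply/negP; rewrite -ltNge.
  rewrite opprD addNKr normrN normrZ.
  rewrite ger0_norm ?divr_ge0 ?(ltW D0) ?(ltW (dA p Ap))// distrC mulrAC ltr_pdivrMr//.
  by rewrite ltr_pM2l// dA.
apply: Aw; have <- : z + (w - z) = w by rewrite addrC subrK.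
move: (w - z) move_in => v move_in.
have := (convex_setP A).1 cA _ _ s t (move_in x Ax) (move_in y Ay) s0 t0 st.
rewrite !scalerDr addrACA -/z !scalerA -scalerDl !mulrA -mulrDl -/D divff ?gt_eqF//.
by rewrite scale1r.
Qed.

End Exhaustion.

(** The norm makes sublevel sets bounded; for open [A] the inverse distance keeps them away from the
    boundary and is convex because the distance is concave on [A]. *)
Lemma exhaustion (R : realType) n (A : set 'rV[R]_n) :
  convex_set A -> open A \/ closed A ->
  exists2 psi, continuous_convex A psi &
    forall t, compact (A `&` [set x | psi x <= t]).
Proof.
move=> cA; have closed_case : closed A -> exists2 psi, continuous_convex A psi &
    forall t, compact (A `&` [set x | psi x <= t]).
  move=> clA; exists (fun x => `|x|); first exact: continuous_convex_norm.
  move=> t; apply: bounded_closed_compact.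
    by apply/boundedP; exists t => x [].
  apply: closedI => //.
  have -> : [set x : 'rV[R]_n | `|x| <= t] = (fun x => `|x|) @^-1` [set y | y <= t] by [].
  by apply: closed_comp => [x _|]; [exact: norm_continuous|exact: closed_le].
move=> [oA|//]; have [A0|A0] := pselect (~` A !=set0); last first.
  apply: closed_case; suff -> : A = setT by exact: closedT.
  by apply/seteqP; split => // x _; apply: contrapT => Ax; apply: A0; exists x.
pose d := dist (~` A); have dcont : continuous d by exact: continuous_dist.
have dA x : A x -> 0 < d x.
  by move=> Ax; apply: dist_gt0 => //; exact: open_closedC.
exists (fun x => `|x| + (d x)^-1).
  apply: continuous_convexD; first exact: continuous_convex_norm.
  split.
    apply/subspace_continuousP => x Ax; apply: cvg_within_filter.
    by apply: cvgV; [rewrite gt_eqF// dA|exact: dcont].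
  apply/convex_functionP => x y s t Ax Ay s0 t0 st.
  apply: le_trans (ler_inv_convex (dA x Ax) (dA y Ay) s0 t0 st).
  have dz := dA _ ((convex_setP A).1 cA x y s t Ax Ay s0 t0 st).
  have dx := dA x Ax; have dy := dA y Ay.
  have D0 := convex_comb_gt0 dx dy s0 t0 st.
  by rewrite lef_pV2 ?posrE; [exact: dist_setC_concave|exact: dz|exact: D0].
(* Clearing the denominator gives conditions on continuous functions of the whole space, hence a
   closed set; membership in [A] is automatic since [d] vanishes outside [A]. *)
move=> t; have -> : A `&` [set x | `|x| + (d x)^-1 <= t] =
    [set x | `|x| <= t] `&` [set x | 1 <= (t - `|x|) * d x].
  apply/seteqP; split => x /= [].
    move=> Ax xt; have dx := dA x Ax; have dV : 0 < (d x)^-1 by rewrite invr_gt0.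
    by split; [lra|rewrite -ler_pdivrMr// mul1r; lra].
  move=> xt xd; have Ax : A x.
    apply: contrapT => /(@dist_mem0 _ _ (~` A)) dx.
    by move: xd; rewrite /d dx mulr0 ler10.
  by split => //; move: xd; rewrite -ler_pdivrMr ?dA// mul1r; lra.
apply: bounded_closed_compact.
  by apply/boundedP; exists t => x [].
apply: closedI.
  apply: (@closed_comp _ _ (fun x : 'rV[R]_n => `|x|) [set y | y <= t]) => [x _|].
    exact: norm_continuous.
  exact: closed_le.
apply: (@closed_comp _ _ (fun x => (t - `|x|) * d x) [set y | 1 <= y]) => [x _|].
  have tx : (fun y : 'rV[R]_n => t - `|y|) @ x --> t - `|x|.
    exact: cvgB (cvg_cst t) (@norm_continuous _ _ x).
  exact: cvgM tx (dcont x).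
exact: closed_ge.
Qed.

(** * Controls for the composition, and the three cases *)

(** With [g = g1 - g2] on [C], the function [k] is an extension of [g2] composed with [F], plus the
    correction from [u] and [v]. It is convex on all of [A], and on [S] the extension cancels [g2],
    leaving corrected [g1 \o F]. *)
Lemma control_comp (R : realType) (E : normedModType R) n (A S : set E)
    (C : set 'rV[R]_n) (F : E -> 'rV[R]_n) (u v : 'I_n -> E -> R)
    (g : 'rV[R]_n -> R) :
  convex_set A -> (forall i, continuous_convex A (u i)) ->
  (forall i, continuous_convex A (v i)) ->
  (forall i x, A x -> F x ord0 i = u i x - v i x) ->
  convex_set S -> S `<=` A -> F @` S `<=` C -> convex_set C -> lipschitz_dc C g ->
  exists k, [/\ continuous_convex A k, convex_function S (fun x => g (F x) + k x) &
    forall T, T `<=` A -> (forall i, [bounded u i x | x in T]) ->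
      (forall i, [bounded v i x | x in T]) -> [bounded k x | x in T]].
Proof.
move=> cA cu cv FE cS SA FS cC [g1 [g2 [[+ g1c] [+ g2c] gE]]].
move=> /lipschitzP[L1 L10 g1L] /lipschitzP[L2 L20 g2L].
(* A common constant lets the same correction serve [g1] and [g2]. *)
pose L := L1 + L2; have L0 : 0 <= L by exact: addr_ge0.
have {}g1L x y : C x -> C y -> `|g1 x - g1 y| <= L * `|x - y|.
  by move=> Cx Cy; rewrite (le_trans (g1L x y Cx Cy))// ler_wpM2r// lerDl.
have {}g2L x y : C x -> C y -> `|g2 x - g2 y| <= L * `|x - y|.
  by move=> Cx Cy; rewrite (le_trans (g2L x y Cx Cy))// ler_wpM2r// lerDr.
have [g2' [g2'L g2'c g2'E]] := lipschitz_convex_extension L0 g2L cC g2c.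
have cF : {within A, continuous F}.
  apply: within_continuous_rV => i.
  by apply: dc_within_continuous; exists (u i), (v i); split=> // x; exact: FE.
exists (fun x => g2' (F x) + L * \sum_i (u i x + v i x)); split.
- split.
    have cgF : {within A, continuous (g2' \o F)}.
      by apply: within_continuous_comp cF => y _; exact: (klipschitz_continuous g2'L).
    apply: within_continuousD => //.
    apply: within_continuousZ; apply: within_continuous_sum => i.
    by apply: within_continuousD; [exact: (cu i).1|exact: (cv i).1].
  apply: (convex_function_comp (C := setT)) => //.
  + by move=> i; exact: (cu i).2.
  + by move=> i; exact: (cv i).2.
- pose w x := g1 (F x) + L * \sum_i (u i x + v i x).
  apply: (@eq_convex_function _ _ _ w) => //.
    move=> x Sx; have CFx : C (F x) by apply: FS; exists x.
    by rewrite /w gE// g2'E// addrA subrK.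
  apply: (convex_function_comp (C := C)) => //.
  + by move=> i; apply: convex_functionS (cu i).2.
  + by move=> i; apply: convex_functionS (cv i).2.
  + by move=> i x /SA; exact: FE.
- move=> T TA ub vb; apply/boundedP.
  have /choice[M Mu] i := (boundedP _ _).1 (ub i).
  have /choice[N Nv] i := (boundedP _ _).1 (vb i).
  exists (`|g2' 0| + L * (\sum_i (M i + N i)) + L * \sum_i (M i + N i)) => x Tx.
  have uv i : `|u i x| + `|v i x| <= M i + N i by rewrite lerD ?Mu ?Nv.
  have Fx : `|F x| <= \sum_i (M i + N i).
    rewrite (le_trans (rV_norm_le_sum _))//; apply: ler_sum => i _.
    by rewrite FE ?(le_trans (ler_normB _ _))//; exact: TA.
  have Sx : `|\sum_i (u i x + v i x)| <= \sum_i (M i + N i).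
    rewrite (le_trans (ler_norm_sum _ _ _))//; apply: ler_sum => i _.
    by rewrite (le_trans (ler_normD _ _)).
  rewrite (le_trans (ler_normD _ _))// lerD//; last first.
    by rewrite normrM ger0_norm// ler_wpM2l.
  have := g2'L (F x) 0; rewrite subr0.
  have := ler_normD (g2' (F x) - g2' 0) (g2' 0); rewrite subrK.
  by have := ler_wpM2l L0 Fx; lra.
Qed.

Lemma dc_add_control (R : realType) (E : normedModType R) (A : set E) (f k : E -> R) :
  {within A, continuous f} -> continuous_convex A k ->
  convex_function A (fun x => f x + k x) -> dc A f.
Proof.
move=> cf kc fk; exists (fun x => f x + k x), k.
split => // [|x _]; last by rewrite addrK.
by split=> //; apply: within_continuousD => //; exact: kc.1.
Qed.

(* The case (c) is a separate conjunct because it fixes the space X = R^k. *)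
Theorem theorem4p2 (R : realType) (n : nat)
    (B : set 'rV[R]_n) (g : 'rV[R]_n -> R)
    (convB : convex_set B) (dcg : dc B g) :
  (forall (X : normedModType R) (A : set X) (F : X -> 'rV[R]_n),
     convex_set A -> F @` A `<=` B -> dc_map A F ->
     (* (a) *)
     (open A /\ lipschitz_dc B g)
     (* (b) *)
     \/ ((forall i, bounded_dc A (fun x => F x ord0 i)) /\
         (forall S : set 'rV[R]_n, S `<=` B -> convex_set S -> bounded_set S ->
            lipschitz_dc S g)) ->
     dc A (g \o F))
  /\
  (* (c) *)
  (forall (k : nat) (A : set 'rV[R]_k) (F : 'rV[R]_k -> 'rV[R]_n),
     convex_set A -> F @` A `<=` B -> dc_map A F ->
     open A \/ closed A ->
     (forall a, A a ->
        exists2 e : R, 0 < e & lipschitz_dc (B `&` ball (F a) e) g) ->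
     dc A (g \o F)).
Proof.
have cF (X : normedModType R) (A : set X) (F : X -> 'rV[R]_n) :
    dc_map A F -> {within A, continuous F}.
  by move=> dcF; apply: within_continuous_rV => i; exact: dc_within_continuous.
have cgF (X : normedModType R) (A : set X) (F : X -> 'rV[R]_n) :
    F @` A `<=` B -> dc_map A F -> {within A, continuous (g \o F)}.
  move=> FB dcF; apply: within_continuous_comp_in FB (cF _ _ _ dcF) _.
  exact: dc_within_continuous.
have dcE (X : normedModType R) (A : set X) (F : X -> 'rV[R]_n) : dc_map A F ->
    exists u v : 'I_n -> X -> R, [/\ forall i, continuous_convex A (u i),
      forall i, continuous_convex A (v i) &
      forall i x, A x -> F x ord0 i = u i x - v i x].
  by move=> /choice[u /choice[v uvE]]; exists u, v; split => i; case: (uvE i).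
split=> [X A F cA FB dcF [[_ lg]|[bF bg]]|k A F cA FB dcF oA lg].
- have [u [v [cu cv FE]]] := dcE _ _ _ dcF.
  have [k [kc gFk _]] := control_comp cA cu cv FE cA (@subset_refl _ A) FB convB lg.
  exact: dc_add_control (cgF _ _ _ FB dcF) kc gFk.
- have /choice[u /choice[v uvE]] := bF.
  have cu i : continuous_convex A (u i) by case: (uvE i) => [[]].
  have cv i : continuous_convex A (v i) by case: (uvE i) => _ [].
  have FE i : forall x, A x -> F x ord0 i = u i x - v i x by case: (uvE i).
  have ub i : bounded_on_bounded A (u i) by case: (uvE i) => [[]].
  have vb i : bounded_on_bounded A (v i) by case: (uvE i) => _ [].
  apply: (dc_of_controls cA (continuous_convex_norm A) (cgF _ _ _ FB dcF)) => m.
  pose S (t : R) := A `&` [set x | `|x| <= t].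
  have SA t : S t `<=` A by exact: subIsetl.
  have Sb t : bounded_set (S t) by apply/boundedP; exists t => x [].
  have [r Fr] : exists r, forall x, S m%:R x -> `|F x| <= r.
    have /choice[M Mu] i := (boundedP _ _).1 (ub i _ (SA m%:R) (Sb _)).
    have /choice[N Nv] i := (boundedP _ _).1 (vb i _ (SA m%:R) (Sb _)).
    exists (\sum_i (M i + N i)) => x Sx.
    rewrite (le_trans (rV_norm_le_sum _))//; apply: ler_sum => i _.
    rewrite FE; last exact: SA Sx.
    by rewrite (le_trans (ler_normB _ _))// lerD ?Mu ?Nv.
  (* A bounded convex part of [B] containing the image of [S m%:R], to which the hypothesis on [g]
     applies. *)
  pose C := B `&` [set y | `|y| <= r].
  have cC : convex_set C by apply: convex_set_sublevel => //; exact: convex_function_norm.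
  have cS : convex_set (S m%:R).
    by apply: convex_set_sublevel => //; exact: convex_function_norm.
  have FC : F @` S m%:R `<=` C.
    by move=> _ [x Sx <-]; split; [apply: FB; exists x => //; exact: Sx.1|exact: Fr].
  have lg : lipschitz_dc C g.
    by apply: bg => //; [exact: subIsetl|apply/boundedP; exists r => y []].
  have [k [kc gFk kb]] := control_comp cA cu cv FE cS (SA _) FC cC lg.
  exists k; split => // t; apply: (kb _ (SA t)) => i.
    exact: (ub i _ (SA t) (Sb t)).
  exact: (vb i _ (SA t) (Sb t)).
- have [psi psic psiK] := exhaustion cA oA.
  have [u [v [cu cv FE]]] := dcE _ _ _ dcF.
  have gFc := cgF _ _ _ FB dcF.
  apply: (dc_of_controls cA psic gFc) => m.
  have [||l lc gFl] := compact_control (psiK m%:R) _ (@subIsetl _ _ _) gFc.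
  + exact: convex_set_sublevel psic.2.
  + move=> a Aa; have [e e0 lga] := lg a Aa.
    (* Continuity of [F] carries the decomposition of [g] near [F a] back to a convex neighborhood
       of [a] in [A]. *)
    have /nbhs_ballP[d /= d0 dF] : nbhs a [set x | A x -> ball (F a) e (F x)].
      have /subspace_continuousP/(_ a Aa) cFa := cF _ _ _ dcF.
      exact: (cFa _ (nbhsx_ballx (F a) _ e0)).
    have cBe := convex_setI convB (@convex_set_ball _ _ (F a) e).
    have cAd := convex_setI cA (@convex_set_ball _ _ a d).
    have FBe : F @` (A `&` ball a d) `<=` B `&` ball (F a) e.
      by move=> _ [x [Ax ax] <-]; split; [apply: FB; exists x|exact: dF].
    have [l [lc gFl _]] := control_comp cA cu cv FE cAd (@subIsetl _ _ _) FBe cBe lga.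
    by exists (ball a d), l; split => //; exact: nbhsx_ballx.
  exists l; split => // t.
  (* Here boundedness on sublevel sets comes from their compactness. *)
  have : compact (l @` (A `&` [set x | psi x <= t])).
    apply: continuous_compact (psiK t).
    by apply: continuous_subspaceW lc.1; exact: subIsetl.
  move=> /compact_bounded /boundedP[M lM]; apply/boundedP; exists M => x Kx.
  by apply: lM; exists x.
Qed.
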